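(* For each nonnegative integer $k$, the map $\pi\mapsto\mathrm{DL}_k(\mathrm{swd}(\pi))$ restricted to $\mathcal U_{2k+1}(132,312)$ is a bijection from $\mathcal U_{2k+1}(132,312)$ to $\mathrm{Int}(\mathcal A_k)=\{(\Lambda,\Lambda):\Lambda\in\mathbf D_k\}$. Hence $|\mathcal U_{2k+1}(132,312)|=C_k=\frac{1}{k+1}\binom{2k}{k}$.
   Context: Permutations are finite words of distinct positive integers; $S_n$ is the set of permutations of $[n]$. The stack-sorting map $s$: $s(\text{empty})=\text{empty}$, and if $\pi=LnR$ with $n$ the largest entry, $s(\pi)=s(L)s(R)n$. $\pi$ is uniquely sorted if it has exactly one preimage under $s$. A permutation avoids $\tau$ if no subsequence has the same relative order as $\tau$; $\mathcal U_n(\tau^{(1)},\dots)$ is the set of uniquely sorted permutations in $S_n$ avoiding the listed patterns. A descent of $\pi$ is an index $i$ with $\pi_i>\pi_{i+1}$; $\mathrm{Des}(\pi)$ is the set of descents. $\mathrm{rev}$ reverses a word, $\mathrm{rot}(\pi)=\mathrm{rev}(\pi^{-1})$ with $\pi^{-1}$ the group inverse. Sliding operators: for $\pi\in S_n$, $i\in[n]$, let $L_i$ (resp. $R_i$) be the set of elements of $[i-1]$ to the left (resp. right) of the entry $i$ in $\pi$. $\mathrm{swu}_i(\pi)$ has $j$-th entry $\pi_j$ if $\pi_j\ge i$, $m$ if $\pi_j$ is the $m$-th smallest element of $R_i$, and $i-m$ if $\pi_j$ is the $m$-th largest element of $L_i$. $\mathrm{swd}_i=\mathrm{rev}\circ\mathrm{swu}_i\circ\mathrm{rev}$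 and $\mathrm{swd}=\mathrm{swd}_1\circ\cdots\circ\mathrm{swd}_n$ on $S_n$. $\mathbf D_k$ is the set of Dyck paths of semilength $k$ (words in $\{U,D\}$ with $k$ of each letter, every prefix having at least as many $U$'s as $D$'s); $\mathcal A_k$ is the antichain on $\mathbf D_k$; $\mathrm{Int}(P)$ is the set of pairs $(x,y)$ with $x\le y$ in $P$. For $\pi\in\mathcal U_{2k+1}(312)$, $n=2k+1$, let $\Lambda_i=D$ if $n-i\in\mathrm{Des}(\pi)$ and $U$ otherwise, $\Lambda'_i=U$ if $i\in\mathrm{Des}(\mathrm{rot}(\pi))$ and $D$ otherwise ($1\le i\le 2k$), and $\mathrm{DL}_k(\pi)=(\Lambda_1\cdots\Lambda_{2k},\Lambda'_1\cdots\Lambda'_{2k})$. *)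

(* Defs.v *)
From HB Require Import structures.
From mathcomp Require Import all_boot.
From mathcomp Require Import boolp classical_sets functions cardinality.

Set Implicit Arguments.
Unset Strict Implicit.
Unset Printing Implicit Defensive.

Local Open Scope classical_set_scope.
Local Open Scope nat_scope.

Definition is_permutation (w : seq nat) : bool := uniq w && (0 \notin w).

Definition Sn (n : nat) : set (seq nat) := [set w | perm_eq w (iota 1 n)].

(* The stack-sorting map, by recursion on an upper bound [m] of the length;
   [stack_sort_nil] and [stack_sort_max] are its defining equations. *)
Fixpoint stack_sort_rec (m : nat) (w : seq nat) : seq nat :=
  match m, w with
  | m'.+1, _ :: _ =>
      let n := \max_(x <- w) x in
      let i := index n w in
      stack_sort_rec m' (take i w) ++ stack_sort_rec m' (drop i.+1 w) ++ [:: n]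
  | _, _ => [::]
  end.

Definition stack_sort (w : seq nat) : seq nat := stack_sort_rec (size w) w.

Lemma stack_sort_recE (m m' : nat) (w : seq nat) :
  size w <= m -> size w <= m' -> stack_sort_rec m w = stack_sort_rec m' w.
Proof.
elim: m m' w => [|m IHm] [|m'] [|x w] //= hm hm'.
have n_in : \max_(y <- x :: w) y \in x :: w.
  have [y hy ->] : exists2 y, y \in x :: w & \max_(y <- x :: w) y = y.
    elim: w x {hm hm' IHm} => [|z w IHw] x.
      by exists x; rewrite ?mem_head // big_seq1.
    rewrite big_cons; have [y hy ->] := IHw z.
    case: (leqP x y) => xy.
      by exists y; rewrite ?(maxn_idPr xy) // inE hy orbT.
    by exists x; rewrite ?mem_head //; apply/maxn_idPl/ltnW.
  by [].
set n := \max_(y <- x :: w) y in n_in *.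
have hi : index n (x :: w) <= size w by rewrite -ltnS -index_mem in n_in *.
have ht : size (take (index n (x :: w)) (x :: w)) <= size w.
  by rewrite size_take; case: ltnP => // /leq_trans; apply.
have hd : size (drop (index n (x :: w)) w) <= size w by rewrite size_drop leq_subr.
rewrite !ltnS in hm hm'.
by congr (_ ++ (_ ++ _)); apply: IHm; first
  [exact: leq_trans ht hm | exact: leq_trans ht hm'
  |exact: leq_trans hd hm | exact: leq_trans hd hm'].
Qed.

Lemma stack_sort_nil : stack_sort [::] = [::].
Proof. by []. Qed.

Lemma stack_sort_max (n : nat) (L R : seq nat) :
  all (fun x => x < n) (L ++ R) ->
  stack_sort (L ++ n :: R) = stack_sort L ++ stack_sort R ++ [:: n].
Proof.
rewrite all_cat => /andP[/allP hL /allP hR].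
have max_n : \max_(x <- L ++ n :: R) x = n.
  rewrite big_cat big_cons /=.
  have ub (s : seq nat) : {in s, forall x, x < n} -> \max_(x <- s) x <= n.
    by move=> hs; apply/bigmax_leqP_seq => x xs _; apply/ltnW/hs.
  by rewrite (maxn_idPl (ub R hR)) (maxn_idPr (ub L hL)).
have nL : n \notin L by apply/negP => /hL; rewrite ltnn.
have ind_n : index n (L ++ n :: R) = size L.
  by rewrite index_cat (negPf nL) /= eqxx addn0.
rewrite /stack_sort.
have -> : size (L ++ n :: R) = (size L + size R).+1 by rewrite size_cat addnS.
have E (w : seq nat) m : w != [::] -> stack_sort_rec m.+1 w =
    stack_sort_rec m (take (index (\max_(x <- w) x) w) w) ++
    stack_sort_rec m (drop (index (\max_(x <- w) x) w).+1 w) ++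
    [:: \max_(x <- w) x] by case: w.
rewrite E; last by case: (L).
rewrite max_n ind_n take_size_cat // drop_cat ltnNge leqnSn /= subSnn drop1 /=.
by congr (_ ++ (_ ++ _)); apply: stack_sort_recE; rewrite ?leq_addr ?leq_addl.
Qed.

Definition uniquely_sorted (w : seq nat) : Prop :=
  exists! v : seq nat, is_permutation v /\ stack_sort v = w.

Definition same_relative_order (u v : seq nat) : Prop :=
  size u = size v /\
  forall i j, i < size u -> j < size u ->
    (nth 0 u i < nth 0 u j) = (nth 0 v i < nth 0 v j).

Definition avoids (w tau : seq nat) : Prop :=
  ~ exists u : seq nat, subseq u w /\ same_relative_order u tau.

Definition Uav (n : nat) (taus : seq (seq nat)) : set (seq nat) :=
  [set w | [/\ Sn n w, uniquely_sorted w
             & forall tau, tau \in taus -> avoids w tau]].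

(* Positions are numbered from 1, as in [w = w_1 ... w_n]. *)
Definition Des (w : seq nat) : seq nat :=
  [seq i <- iota 1 (size w).-1 | nth 0 w i.-1 > nth 0 w i].

Definition inverse (w : seq nat) : seq nat :=
  [seq (index x w).+1 | x <- iota 1 (size w)].

Definition rot_perm (w : seq nat) : seq nat := rev (inverse w).

Definition left_smaller (i : nat) (w : seq nat) : seq nat :=
  [seq x <- take (index i w) w | x < i].

Definition right_smaller (i : nat) (w : seq nat) : seq nat :=
  [seq x <- drop (index i w) w | x < i].

Definition swu_at (i : nat) (w : seq nat) : seq nat :=
  [seq if i <= x then x
       else if x \in right_smaller i w
       then (index x (sort leq (right_smaller i w))).+1
       else i - (index x (sort geq (left_smaller i w))).+1
  | x <- w].

Definition swd_at (i : nat) (w : seq nat) : seq nat := rev (swu_at i (rev w)).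

(* [foldr] applies [swd_at n] first and [swd_at 1] last. *)
Definition swd (w : seq nat) : seq nat := foldr swd_at w (iota 1 (size w)).

Definition stepU : bool := true.
Definition stepD : bool := false.

Definition Dyck (k : nat) : set (seq bool) :=
  [set p | [/\ count_mem stepU p = k, count_mem stepD p = k
             & forall m, count_mem stepD (take m p) <= count_mem stepU (take m p)]].

Definition Int (T : Type) (P : set T) (le : T -> T -> Prop) : set (T * T) :=
  [set xy | [/\ P xy.1, P xy.2 & le xy.1 xy.2]].

Definition Int_antichain (k : nat) : set (seq bool * seq bool) :=
  Int (Dyck k) eq.

Definition DL (k : nat) (w : seq nat) : seq bool * seq bool :=
  ([seq if k.*2.+1 - i \in Des w then stepD else stepU | i <- iota 1 k.*2],
   [seq if i \in Des (rot_perm w) then stepU else stepD | i <- iota 1 k.*2]).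

Definition catalan (k : nat) : nat := 'C(k.*2, k) %/ k.+1.

(* The quotient in [catalan] is exact. *)
Lemma catalanE (k : nat) : k.+1 * catalan k = 'C(k.*2, k).
Proof.
have h : k.+1 * 'C(k.*2, k.+1) = k * 'C(k.*2, k).
  by rewrite mul_bin_left -addnn addnK.
have d : k.+1 %| 'C(k.*2, k).
  apply/dvdnP; exists ('C(k.*2, k) - 'C(k.*2, k.+1)).
  by rewrite mulnC mulnBr h mulSn addnK.
by rewrite mulnC divnK.
Qed.

(* Main.v *)
Require Import Defs.
From mathcomp Require Import all_boot zify.
From mathcomp Require Import boolp classical_sets functions cardinality.

(* Every suffix of a stack-sorted word has at least as many ascents as descents, and its
   preimage is unique exactly when the whole word has as many ascents as descents.
   Conversely a 312-avoiding word with this property is sorted: cut it along the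
   first-return decomposition of its Dyck word. So, for 312-avoiding words of size 2k+1,
   being uniquely sorted only depends on the descents.  An entry of a
   {132,312}-avoiding word is a new maximum or a new minimum, so the descents determine
   the word and are arbitrary.  Each [swd_at i] preserves the descents and the avoidance
   of 312, and destroys the occurrences of 231 whose top entry is [i]; hence [swd w] is
   the layered permutation with the descents of [w].  A layered permutation is an
   involution, so both components of its image under [DL] are the same Dyck word. *)

Set Implicit Arguments.
Unset Strict Implicit.
Unset Printing Implicit Defensive.

Local Open Scope classical_set_scope.
Local Open Scope nat_scope.

(** * Ascents and descents *)

(** An ascent is encoded as [true], which is also [stepU]. Read backwards, the step word is then the
    first component of [DL], see [DL1_steps]. *)
Definition steps (w : seq nat) : seq bool :=
  if w is x :: s then pairmap ltn x s else [::].

Lemma size_steps (w : seq nat) : size (steps w) = (size w).-1.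
Proof. by case: w => //= x s; rewrite size_pairmap. Qed.

Lemma nth_steps (w : seq nat) (i : nat) : i.+1 < size w ->
  nth stepD (steps w) i = (nth 0 w i < nth 0 w i.+1).
Proof. by case: w => //= x s hi; rewrite (nth_pairmap 0). Qed.

Lemma steps_cat (u v : seq nat) : u != [::] -> v != [::] ->
  steps (u ++ v) = steps u ++ (last 0 u < head 0 v) :: steps v.
Proof. by case: u v => // x u [] // y v _ _; rewrite /= pairmap_cat. Qed.

Lemma steps_catP (w : seq nat) (p q : seq bool) (b : bool) :
  steps w = p ++ b :: q ->
  exists u v, [/\ w = u ++ v, (u != [::]) && (v != [::]), steps u = p,
                 steps v = q & b = (last 0 u < head 0 v)].
Proof.
move=> E; have sw : size w = (size p + size q).+2.
  have := size_steps w; rewrite E size_cat /=.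
  by case: (w) => [|x s] /=; lia.
pose u := take (size p).+1 w; pose v := drop (size p).+1 w.
have su : size u = (size p).+1 by rewrite size_takel // sw; lia.
have sv : size v = (size q).+1 by rewrite size_drop sw; lia.
have u0 : u != [::] by rewrite -size_eq0 su.
have v0 : v != [::] by rewrite -size_eq0 sv.
exists u, v; move: E; rewrite -{1}(cat_take_drop (size p).+1 w) steps_cat // -/u -/v.
move=> /eqP; rewrite eqseq_cat ?size_steps ?su // eqseq_cons.
by case/and3P => /eqP-> /eqP<- /eqP->; rewrite u0 v0 cat_take_drop.
Qed.

(* Dyck prefixes of [rev q] are suffixes of [q]. *)
Definition suffix_nonneg (q : seq bool) : Prop :=
  forall m, count_mem stepD (drop m q) <= count_mem stepU (drop m q).

Lemma suffix_nonneg_count (q : seq bool) :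
  suffix_nonneg q -> count_mem stepD q <= count_mem stepU q.
Proof. by move/(_ 0); rewrite drop0. Qed.

Lemma suffix_nonneg_cat (p q : seq bool) :
  suffix_nonneg p -> suffix_nonneg q -> suffix_nonneg (p ++ q).
Proof.
move=> hp hq m; rewrite drop_cat; case: ifP => _; last exact: hq.
by rewrite !count_cat leq_add // suffix_nonneg_count.
Qed.

Lemma suffix_nonneg_cons (b : bool) (q : seq bool) :
  suffix_nonneg q -> count_mem stepD (b :: q) <= count_mem stepU (b :: q) ->
  suffix_nonneg (b :: q).
Proof. by move=> hq h [|m] //=; apply: hq. Qed.

Lemma Dyck_revP (k : nat) (q : seq bool) :
  Dyck k (rev q) <-> [/\ size q = k.*2, count_mem stepU q = k & suffix_nonneg q].
Proof.
have cq : count_mem stepU q + count_mem stepD q = size q.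
  by rewrite -(count_predC (pred1 stepU)); congr (_ + _); apply: eq_count; case.
rewrite /Dyck /mkset !count_rev; split=> [[hU hD h]|[sz hU h]].
  split=> [|//|m]; first by rewrite -cq hU hD addnn.
  have := h (size q - m); rewrite take_rev !count_rev.
  have [le|lt] := leqP m (size q); first by rewrite subKn.
  by rewrite [drop m q]drop_oversize // ltnW.
by split=> [//||m]; [lia|rewrite take_rev !count_rev].
Qed.

(** * Preimages under stack-sorting *)

(** Induction along the decomposition around the largest entry. It replaces the recursion on a
    length bound in [stack_sort_rec]; distinct entries make the maximum strict on both sides. *)
Lemma stack_sort_ind (P : seq nat -> Prop) :
  P [::] ->
  (forall L n R, all (fun x => x < n) (L ++ R) -> uniq (L ++ R) ->
     P L -> P R -> P (L ++ n :: R)) ->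
  forall v, uniq v -> P v.
Proof.
move=> P0 PS v; have [m] := ubnP (size v); elim: m v => // m IHm v.
case: v => [//|y v] sv uv.
have n_in : \max_(x <- y :: v) x \in y :: v.
  elim: (v) y {sv uv} => [|z w IHw] y; first by rewrite big_seq1 mem_head.
  rewrite big_cons; have := IHw z; case: (leqP y (\max_(x <- z :: w) x)) => // _ hx.
  - by rewrite inE hx orbT.
  - by rewrite mem_head.
move: (y :: v) sv uv n_in => w sw uw; set n := \max_(x <- w) x => n_in.
have ub : all (fun x => x <= n) w.
  by apply/allP => x xw; rewrite /n (big_rem x) //= leq_maxl.
case/path.splitPr: n_in sw uw ub => L R; clearbody n.
rewrite size_cat /= ltnS => sw.
rewrite uniq_catC /= mem_cat negb_or.
case/andP => /andP[nR nL] uLR; rewrite all_cat /= => /and3P[aL _ aR].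
have uLR' : uniq (L ++ R) by rewrite uniq_catC.
apply: PS => //; last 2 first.
- apply: IHm; last by rewrite cat_uniq in uLR'; case/and3P: uLR'.
  by apply: leq_trans sw; rewrite addnS ltnS leq_addr.
- apply: IHm; last by rewrite cat_uniq in uLR'; case/and3P: uLR'.
  by apply: leq_trans sw; rewrite addnS ltnS leq_addl.
apply/allP => x; rewrite mem_cat ltn_neqAle => /orP[] hx.
- by rewrite (allP aL) // andbT; apply: contraNneq nL => <-.
- by rewrite (allP aR) // andbT; apply: contraNneq nR => <-.
Qed.

Lemma perm_stack_sort (v : seq nat) : uniq v -> perm_eq (stack_sort v) v.
Proof.
elim/stack_sort_ind => // L n R aLR _ pL pR.
by rewrite stack_sort_max // perm_cat // cats1 perm_rcons perm_cons.
Qed.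

Lemma size_stack_sort (v : seq nat) : uniq v -> size (stack_sort v) = size v.
Proof. by move=> uv; apply: perm_size (perm_stack_sort uv). Qed.

Lemma stack_sort_eq0 (v : seq nat) :
  uniq v -> (stack_sort v == [::]) = (v == [::]).
Proof. by move=> uv; rewrite -!size_eq0 size_stack_sort. Qed.

Lemma last_stack_sort_lt (v : seq nat) (n : nat) :
  uniq v -> v != [::] -> all (fun x => x < n) v -> last 0 (stack_sort v) < n.
Proof.
move=> uv v0 /allP; apply; rewrite -(perm_mem (perm_stack_sort uv)).
have := stack_sort_eq0 uv; case: (stack_sort v) => [|x s] /=; first by rewrite (negPf v0).
by rewrite mem_last.
Qed.

(** The maximum, placed last, contributes a final ascent unless it stands alone. The only step that
    is not inherited or forced is the junction between the images of [L] and [R]. *)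
Variant stack_sort_steps_spec (L R : seq nat) : seq bool -> Prop :=
| StepsSingle of L = [::] & R = [::] : stack_sort_steps_spec L R [::]
| StepsLeft of L != [::] & R = [::] :
    stack_sort_steps_spec L R (rcons (steps (stack_sort L)) stepU)
| StepsRight of L = [::] & R != [::] :
    stack_sort_steps_spec L R (rcons (steps (stack_sort R)) stepU)
| StepsBoth of L != [::] & R != [::] :
    stack_sort_steps_spec L R
      (steps (stack_sort L) ++
       (last 0 (stack_sort L) < head 0 (stack_sort R)) ::
       rcons (steps (stack_sort R)) stepU).

Lemma stack_sort_stepsP (L R : seq nat) (n : nat) :
  all (fun x => x < n) (L ++ R) -> uniq (L ++ R) ->
  stack_sort_steps_spec L R (steps (stack_sort (L ++ n :: R))).
Proof.
move=> aLR; rewrite stack_sort_max // cat_uniq => /and3P[uL _ uR].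
move: aLR; rewrite all_cat => /andP[aL aR].
have S (v : seq nat) : uniq v -> v != [::] -> all (fun x => x < n) v ->
    steps (stack_sort v ++ [:: n]) = rcons (steps (stack_sort v)) stepU.
  by move=> uv v0 av; rewrite steps_cat ?stack_sort_eq0 //= last_stack_sort_lt // cats1.
have [L0|L0] := eqVneq L [::]; have [R0|R0] := eqVneq R [::].
- by rewrite L0 R0; constructor.
- by rewrite {2}L0 /= S //; constructor.
- by rewrite {2}R0 /= S //; constructor.
rewrite steps_cat ?stack_sort_eq0 //; last by case: (stack_sort R).
rewrite S // [head 0 _](_ : _ = head 0 (stack_sort R)); first by constructor.
by have := stack_sort_eq0 uR; rewrite (negPf R0); case: (stack_sort R).
Qed.

(** A descent at the junction of the two images is paid for by the ascent to the final maximum. *)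
Lemma suffix_nonneg_stack_sort (v : seq nat) :
  uniq v -> suffix_nonneg (steps (stack_sort v)).
Proof.
elim/stack_sort_ind => // L n R aLR uLR pL pR.
have gU : suffix_nonneg [:: stepU] by case.
case: (stack_sort_stepsP aLR uLR) => [||| _ _]; rewrite -?cats1.
- by [].
- by move=> _ _; apply: suffix_nonneg_cat.
- by move=> _ _; apply: suffix_nonneg_cat.
apply: suffix_nonneg_cat => //; apply: suffix_nonneg_cons.
  exact: suffix_nonneg_cat.
by have := suffix_nonneg_count pR; rewrite /= !count_cat /=; case: (_ < _) => /=; lia.
Qed.

(** * Uniqueness of the preimage *)

(** The maximum [n] of [R = R1 n R2] exceeds all of [L], so [L] only joins the part [R1] left of
    [n]. If [R1] is nonempty, the image of [R] begins with that of [R1], and the hypothesis on its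
    first entry is inherited. *)
Lemma stack_sort_cat (L R : seq nat) :
  uniq (L ++ R) ->
  (forall x y, x \in L -> y = head 0 (stack_sort R) -> x < y) ->
  stack_sort (L ++ R) = stack_sort L ++ stack_sort R.
Proof.
rewrite cat_uniq => /and3P[_ _ uR]; elim/stack_sort_ind: R / uR => [|R1 n R2 aR uR IH _ hd].
  by rewrite !cats0.
have hR1 : R1 = [::] \/ R1 != [::] by case: (R1); [left|right].
have uR1 : uniq R1 by rewrite cat_uniq in uR; case/and3P: uR.
have aL : all (fun x => x < n) L.
  apply/allP => x xL; apply: leq_trans (hd _ _ xL erefl) _.
  rewrite stack_sort_max //.
  have := perm_stack_sort uR1; have := aR; rewrite all_cat => /andP[/allP aR1 _].
  case: (stack_sort R1) => [|y s] /perm_mem pm /=.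
    have uR2 : uniq R2 by rewrite cat_uniq in uR; case/and3P: uR.
    have := perm_stack_sort uR2; have := aR; rewrite all_cat => /andP[_ /allP aR2].
    case: (stack_sort R2) => [|y s] //= /perm_mem pm2.
    by apply/ltnW/aR2; rewrite -pm2 mem_head.
  by apply/ltnW/aR1; rewrite -pm mem_head.
rewrite catA !stack_sort_max //; last by rewrite -catA all_cat aL.
rewrite [in RHS]catA; congr (_ ++ _).
case: hR1 => [->|R10]; first by rewrite !cats0.
apply: IH => x y xL ->; apply: hd xL _.
rewrite stack_sort_max //.
by have := stack_sort_eq0 uR1; rewrite (negPf R10); case: (stack_sort R1).
Qed.

(** If one side of the maximum [n] is empty, move [n] to the other end. If one side has a surplus of
    ascents, change that side by induction. Otherwise the surplus forces an ascent at the junction,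
    and [n :: L ++ R] has the same image. *)
Lemma stack_sort_not_inj (v : seq nat) :
  uniq v ->
  count_mem stepD (steps (stack_sort v)) < count_mem stepU (steps (stack_sort v)) ->
  exists v', [/\ v' <> v, perm_eq v' v & stack_sort v' = stack_sort v].
Proof.
elim/stack_sort_ind => [//|L n R aLR uLR IHL IHR].
have nX (x : nat) (s t u : seq nat) : all (fun x => x < n) s -> s != [::] ->
    s ++ t <> n :: u.
  by case: s => //= y s /andP[yn _] _ [E]; rewrite E ltnn in yn.
have aL := aLR; rewrite all_cat in aL; case/andP: aL => aL aR.
have uL := uLR; rewrite cat_uniq in uL; case/and3P: uL => uL _ uR.
case: (stack_sort_stepsP aLR uLR) => [||| L0 R0].
- by [].
- move=> L0 -> _; exists (n :: L); split; first by move/esym; apply: nX.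
    by rewrite -[L ++ _]/(L ++ [:: n] ++ [::]) cats0 cats1 perm_sym perm_rcons.
  by rewrite -[n :: L]cat0s !stack_sort_max //= cats0.
- move=> -> R0 _; exists (R ++ [:: n]); split; first exact: nX.
    by rewrite cats1 perm_rcons.
  by rewrite -[n :: R]cat0s !stack_sort_max //= cats0.
have sub (L' R' : seq nat) : L' ++ n :: R' <> L ++ n :: R ->
    perm_eq L' L -> perm_eq R' R ->
    stack_sort L' = stack_sort L -> stack_sort R' = stack_sort R ->
    exists v', [/\ v' <> L ++ n :: R, perm_eq v' (L ++ n :: R)
                 & stack_sort v' = stack_sort (L ++ n :: R)].
  move=> ne pL pR eL eR; exists (L' ++ n :: R'); split=> //.
    by apply: perm_cat; rewrite ?perm_cons.
  rewrite !stack_sort_max ?eL ?eR //.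
  by rewrite all_cat (perm_all _ pL) (perm_all _ pR) aL.
have [bL|bL] := ltnP (count_mem stepD (steps (stack_sort L)))
                     (count_mem stepU (steps (stack_sort L))).
  have [L' [ne pL eL]] := IHL bL; move=> _; apply: (sub L' R) => // /eqP.
  by rewrite eqseq_cat ?(perm_size pL) // => /andP[/eqP].
have [bR|bR] := ltnP (count_mem stepD (steps (stack_sort R)))
                     (count_mem stepU (steps (stack_sort R))).
  have [R' [ne pR eR]] := IHR bR; move=> _; apply: (sub L R') => // /eqP.
  by rewrite eqseq_cat // => /andP[_ /eqP[]].
case: (ltnP (last 0 _) _) => [lt _|_ h]; last first.
  by exfalso; move: h bL bR; rewrite -cats1 !count_cat /= !count_cat /=; lia.
(* The image of [L] ends with its maximum, so an ascent at the junction puts all of [L] below the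
   first entry of the image of [R], as [stack_sort_cat] requires. *)
have mx (x : nat) : x \in L -> x <= last 0 (stack_sort L).
  elim/stack_sort_ind: L / uL {aLR uLR IHL nX aL sub bL lt L0} => // L1 m L2 aL _ _ _.
  rewrite stack_sort_max // !last_cat /=.
  rewrite mem_cat inE orbCA -mem_cat => /orP[/eqP->//|xL].
  by apply/ltnW/(allP aL).
exists (n :: L ++ R); split.
- by move/esym; apply: nX.
- by rewrite -cat_rcons -cat_cons perm_cat // perm_sym perm_rcons.
rewrite -[n :: L ++ R]cat0s !stack_sort_max //= stack_sort_cat // ?catA //.
by move=> x y /mx xL ->; apply: leq_ltn_trans lt.
Qed.

(* Two such splittings at different places would leave, inside [q] or [q'], a
   suffix with more descents than ascents. *)
Lemma steps_split_uniq (p q p' q' : seq bool) :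
  suffix_nonneg q -> suffix_nonneg q' ->
  count_mem stepU q = count_mem stepD q -> count_mem stepU q' = count_mem stepD q' ->
  p ++ stepD :: q = p' ++ stepD :: q' -> size p = size p'.
Proof.
wlog le : p q p' q' / size p <= size p' => [W gq gq' eq eq' E|].
  have [le|/ltnW le] := leqP (size p) (size p'); first exact: (W p q p' q').
  by symmetry; exact: (W p' q' p q).
move=> gq _ _ eq' E; move: le; rewrite leq_eqVlt => /orP[/eqP//|lt].
have := congr1 (drop (size p')) E; rewrite [RHS]drop_size_cat // drop_cat ltnNge ltnW //=.
have -> : size p' - size p = (size p' - size p).-1.+1 by lia.
by move=> /= Eq; have := gq (size p' - size p).-1; move: eq'; rewrite Eq /=; lia.
Qed.

(** Neither image has more descents than ascents, and the final step is an ascent. Without a surplus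
    overall, the junction must be a descent and both images must be balanced. *)
Lemma stack_sort_steps_balanced (L R : seq nat) (n : nat) :
  let q := steps (stack_sort (L ++ n :: R)) in
  let p := steps (stack_sort L) in let r := steps (stack_sort R) in
  all (fun x => x < n) (L ++ R) -> uniq (L ++ R) ->
  count_mem stepU q <= count_mem stepD q ->
  (L = [::] /\ R = [::]) \/
  [/\ L != [::], q = p ++ stepD :: rcons r stepU,
      count_mem stepU p = count_mem stepD p & count_mem stepU r = count_mem stepD r].
Proof.
move=> q p r aLR uLR; have := uLR; rewrite cat_uniq => /and3P[uL _ uR].
have := suffix_nonneg_count (suffix_nonneg_stack_sort uL).
have := suffix_nonneg_count (suffix_nonneg_stack_sort uR).
rewrite {}/q -/p -/r.
case: (stack_sort_stepsP aLR uLR) => [L0 R0|_ _|_ _|L0 _]; first by left.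
- by rewrite -cats1 !count_cat /= -/p => _ h; lia.
- by rewrite -cats1 !count_cat /= -/r => h; lia.
rewrite -cats1 !count_cat /= !count_cat /= -/p -/r => hr hp h; right.
by move: h; case: (_ < _) => /= h; split=> //=; lia.
Qed.

(** The maximum is the last entry of the common image. The junction of the two parts is determined
    by the step word through [steps_split_uniq], so the left parts have equal length, the images
    agree part by part, and induction applies. *)
Lemma stack_sort_inj (v v' : seq nat) :
  uniq v -> uniq v' -> stack_sort v = stack_sort v' ->
  count_mem stepU (steps (stack_sort v)) <= count_mem stepD (steps (stack_sort v)) ->
  v = v'.
Proof.
move=> uv; elim/stack_sort_ind: v / uv v' => [v' uv' /esym/eqP|L n R aLR uLR IHL IHR v' uv'].
  by rewrite stack_sort_eq0 // => /eqP.
elim/stack_sort_ind: v' / uv' => [|L' n' R' aLR' uLR' _ _].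
  by rewrite stack_sort_max // => /eqP; rewrite -size_eq0 !size_cat /= !addnS.
move=> E le; have := le; rewrite E => /(stack_sort_steps_balanced aLR' uLR').
have {le} := stack_sort_steps_balanced aLR uLR le.
move: (uLR) (uLR'); rewrite !cat_uniq => /and3P[uL _ uR] /and3P[uL' _ uR'].
have sz : size L + size R = size L' + size R'.
  have := congr1 size E; rewrite !stack_sort_max // !size_cat /=.
  by rewrite !size_stack_sort //; lia.
have En : n = n'.
  by have := congr1 (last 0) E; rewrite !stack_sort_max // !last_cat.
case=> [[L0 R0]|[L0 Eq bL bR]]; case=> [[L0' R0']|[L0' Eq' bL' bR']].
- by rewrite L0 R0 L0' R0' En.
- by case: (L') L0' sz => //; rewrite L0 R0.
- by case: (L) L0 sz => //; rewrite L0' R0'.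
have sL : size L = size L'.
  have := steps_split_uniq (suffix_nonneg_stack_sort uR) (suffix_nonneg_stack_sort uR') bR bR'.
  move=> /(_ (steps (stack_sort L)) (steps (stack_sort L'))).
  rewrite !size_steps !size_stack_sort //.
  (* Both step words end with the ascent to the maximum; it is stripped before the splittings are
     compared. *)
  have : rcons (steps (stack_sort L) ++ stepD :: steps (stack_sort R)) stepU =
         rcons (steps (stack_sort L') ++ stepD :: steps (stack_sort R')) stepU.
    by rewrite !rcons_cat !rcons_cons -Eq -Eq' E.
  move=> /rcons_inj[->] /(_ erefl).
  by case: (L) (L') L0 L0' => [|??] [|??] //= _ _ ->.
subst n'; have := E; rewrite !stack_sort_max // => /eqP.
rewrite eqseq_cat ?size_stack_sort // => /andP[/eqP EL].
rewrite eqseq_cat; last first.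
  by apply/eqP; rewrite !size_stack_sort // -(eqn_add2l (size L)) sz sL.
case/andP=> [/eqP ER _].
have -> : L = L' by apply: IHL => //; move: bL => /= ->.
by have -> : R = R' by apply: IHR => //; move: bR => /= ->.
Qed.

(** * Existence of a preimage for 312-avoiding words *)

(** Cut off the shortest nonempty balanced suffix. All its proper nonempty suffixes have a surplus
    of ascents, so it starts with [stepD] and ends with [stepU]. *)
Lemma suffix_nonneg_first_return (q : seq bool) :
  suffix_nonneg q -> count_mem stepU q = count_mem stepD q -> q != [::] ->
  exists p r, [/\ q = p ++ stepD :: rcons r stepU,
    suffix_nonneg p /\ count_mem stepU p = count_mem stepD p
    & suffix_nonneg r /\ count_mem stepU r = count_mem stepD r].
Proof.
move=> gq bq q0.
pose bal m := (m < size q) && (count_mem stepU (drop m q) == count_mem stepD (drop m q)).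
have ex0 : exists m, bal m by exists 0; rewrite /bal drop0 bq eqxx andbT lt0n size_eq0.
have ub m : bal m -> m <= size q by case/andP => /ltnW.
case: (ex_maxnP ex0 ub) => m /andP[lt /eqP bm] mx.
have up l : m < l -> l < size q -> count_mem stepD (drop l q) < count_mem stepU (drop l q).
  move=> ml lq; rewrite ltn_neqAle gq andbT; apply/negP => /eqP bl.
  by have := mx l; rewrite /bal lq bl eqxx leqNgt ml => /(_ isT).
move: bm; rewrite (drop_nth stepD lt) => bm.
have [mq|mq] := ltnP m.+1 (size q); last first.
  by move: bm; rewrite drop_oversize //=; case: (nth _ _ _).
have b0 : nth stepD q m = stepD.
  by move: bm (up _ (ltnSn m) mq) => /=; case: (nth _ _ _) => //=; lia.
rewrite b0 in bm.
have El : last stepD (drop m.+1 q) = stepU.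
  move: (up (size q).-1); rewrite -nth_last nth_drop size_drop.
  rewrite (drop_nth stepD); last by lia.
  rewrite drop_oversize; last by lia.
  rewrite (_ : m.+1 + _ = (size q).-1); last by lia.
  by case: (nth _ _ _) => //= h; suff : 1 + 0 < 0 + 0 by []; apply: h; lia.
case/lastP Er : (drop m.+1 q) El => [|r b].
  by have := congr1 size Er; rewrite size_drop /=; lia.
rewrite last_rcons => Eb; rewrite {}Eb in Er.
have Eq : q = take m q ++ stepD :: rcons r stepU.
  by rewrite -Er -b0 -drop_nth // cat_take_drop.
have br : count_mem stepU r = count_mem stepD r.
  by move: bm; rewrite Er -cats1 /= !count_cat /=; lia.
exists (take m q), r; split=> //; split=> //.
- move=> l; have [lm|lm] := ltnP l m; last first.
    by rewrite drop_oversize // size_take lt.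
  have Ed : drop l q = drop l (take m q) ++ stepD :: rcons r stepU.
    by rewrite {1}Eq drop_cat size_take lt lm.
  by have := gq l; rewrite Ed -cats1 !count_cat /= !count_cat /=; move: br => /=; lia.
- by move: bq; rewrite {1 2}Eq -cats1 !count_cat /= !count_cat /=; move: br => /=; lia.
(* A nonempty suffix of [r] followed by the final ascent has a strict surplus by [up], so it keeps a
   nonnegative one without that ascent. *)
move=> l; have [lr|lr] := ltnP l (size r); last by rewrite drop_oversize.
have sr : m.+1 + (size r).+1 = size q.
  by have := congr1 size Er; rewrite size_drop size_rcons; lia.
have := up (l + m.+1); rewrite -drop_drop Er drop_rcons; last by lia.
by rewrite -cats1 !count_cat /= => h; have := h ltac:(lia) ltac:(lia); lia.
Qed.

(** Avoidance in terms of positions, equivalent to [avoids] by [avoids312P]; it suits the sliding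
    operators, which change entries in place. *)
Definition avoids312 (w : seq nat) : Prop :=
  forall a b c, a < b -> b < c -> c < size w ->
    ~ (nth 0 w b < nth 0 w c < nth 0 w a).

Lemma avoids312_catl (u v : seq nat) : avoids312 (u ++ v) -> avoids312 u.
Proof.
move=> h a b c ab bc cu; have := h a b c ab bc; rewrite !nth_cat size_cat.
have bu := ltn_trans bc cu; have au := ltn_trans ab bu.
by rewrite cu bu au; apply; apply: ltn_addr.
Qed.

Lemma avoids312_catr (u v : seq nat) : avoids312 (u ++ v) -> avoids312 v.
Proof.
move=> h a b c ab bc cv.
have E i : nth 0 (u ++ v) (size u + i) = nth 0 v i.
  by rewrite nth_cat ltnNge leq_addr /= addKn.
have := h (size u + a) (size u + b) (size u + c).
by rewrite !E size_cat !ltn_add2l; apply.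
Qed.

(** The first-return decomposition cuts [w] into [u ++ v ++ [:: n]] with an ascent into [n]. Here
    [n] is the maximum: a larger entry, the last entry of [v] and [n] would form a 312. Preimages
    [U] of [u] and [V] of [v] then give the preimage [U ++ n :: V]. *)
Lemma stack_sort_surj (w : seq nat) :
  is_permutation w -> w != [::] -> avoids312 w -> suffix_nonneg (steps w) ->
  count_mem stepU (steps w) = count_mem stepD (steps w) ->
  exists v, is_permutation v /\ stack_sort v = w.
Proof.
have [m] := ubnP (size w); elim: m w => // m IHm w sw pw w0 aw gw bw.
have [s0|s0] := eqVneq (steps w) [::].
  exists w; split=> //.
  case: w s0 {sw pw w0 aw gw bw} => [|x [|y w]] // _.
  exact: (@stack_sort_max x [::] [::]).
have [p [r [Ew [gp bp] [gr br]]]] := suffix_nonneg_first_return gw bw s0.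
have [u [z [Ewz /andP[u0 z0] Eu Ez _]]] := steps_catP Ew.
rewrite -cats1 in Ez; have [v [t [Ezt /andP[v0 t0] Ev Et lt]]] := steps_catP Ez.
case: t Et t0 Ezt lt => [|n [|? ?]] //= _ _ Ezt lt; subst z w.
have aln : all (fun x => x < n) (u ++ v).
  apply/allP => x xuv; rewrite ltnNge; apply/negP => le.
  case/andP: pw => uw _; move: uw; rewrite catA cats1 rcons_uniq => /andP[nuv _].
  have xn : n < x.
    by rewrite ltn_neqAle le andbT; apply: contraNneq nuv => ->.
  have [i ilt Ei] : exists2 i, i < size (u ++ v) & nth 0 (u ++ v) i = x.
    by exists (index x (u ++ v)); rewrite ?index_mem ?nth_index.
  have El : last 0 v = nth 0 (u ++ v) (size (u ++ v)).-1.
    by rewrite nth_last last_cat; case: (v) v0.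
  have ine : i != (size (u ++ v)).-1.
    by apply/eqP => ie; move: lt; rewrite El -ie Ei ltnNge (ltnW xn).
  have := aw i (size (u ++ v)).-1 (size (u ++ v)).
  rewrite catA; move: (u ++ v) ilt Ei El ine => z ilt Ei El ine.
  rewrite [size (_ ++ [:: n])]size_cat addn1 ltnSn !nth_cat ltnn subnn /= ilt Ei.
  have -> : (size z).-1 < size z by clear -ilt; lia.
  by rewrite -El -lt xn; apply => //; clear -ilt ine; lia.
have [/andP[uw zw] sz] := (pw, size_cat u (v ++ [:: n])).
move: uw zw; rewrite !cat_uniq !mem_cat !negb_or has_cat negb_or => /and3P[uu /andP[duv _]].
case/and3P => uv _ _ /and3P[zu zv _].
have [||||||U [pU EU]] := IHm u; rewrite ?Eu //.
- by clear -sw; move: sw; rewrite !size_cat /=; lia.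
- by rewrite /is_permutation uu.
- exact: avoids312_catl aw.
have [||||||V [pV EV]] := IHm v; rewrite ?Ev //.
- by clear -sw; move: sw; rewrite !size_cat /=; lia.
- by rewrite /is_permutation uv.
- exact: avoids312_catl (avoids312_catr aw).
have mU : perm_eq u U by rewrite -EU perm_stack_sort //; case/andP: pU.
have mV : perm_eq v V by rewrite -EV perm_stack_sort //; case/andP: pV.
exists (U ++ n :: V); split; last first.
  by rewrite stack_sort_max ?EU ?EV // all_cat -(perm_all _ mU) -(perm_all _ mV) -all_cat.
have pp : perm_eq (U ++ n :: V) (u ++ v ++ [:: n]).
  by rewrite perm_sym perm_cat // cats1 perm_rcons perm_cons.
by move: pw; rewrite /is_permutation (perm_uniq pp) (perm_mem pp).
Qed.

(** * Uniquely sorted permutations and Dyck words *)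

Lemma Sn_is_permutation (n : nat) (w : seq nat) : Sn n w -> is_permutation w.
Proof.
move=> pw; rewrite /is_permutation (perm_uniq pw) iota_uniq (perm_mem pw).
by rewrite mem_iota.
Qed.

Lemma Sn_size (n : nat) (w : seq nat) : Sn n w -> size w = n.
Proof. by move=> /perm_size; rewrite size_iota. Qed.

Lemma uniquely_sorted_Dyck (k : nat) (w : seq nat) :
  Sn k.*2.+1 w -> uniquely_sorted w -> Dyck k (rev (steps w)).
Proof.
move=> Sw [v [[pv Ev] uniqv]]; case/andP: (pv) => uv zv.
have gw : suffix_nonneg (steps w) by rewrite -Ev; apply: suffix_nonneg_stack_sort.
apply/Dyck_revP; split=> //; first by rewrite size_steps (Sn_size Sw).
have le : count_mem stepU (steps w) <= count_mem stepD (steps w).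
  rewrite leqNgt; apply/negP; rewrite -Ev => /(stack_sort_not_inj uv) [v' [ne pp E]].
  apply: ne; symmetry; apply: uniqv; split; last by rewrite E.
  by move: pv; rewrite /is_permutation (perm_uniq pp) (perm_mem pp).
have := size_steps w; rewrite (Sn_size Sw) -(count_predC (pred1 stepU)) /=.
rewrite (_ : count (predC _) _ = count_mem stepD (steps w)); last by apply: eq_count; case.
have := suffix_nonneg_count gw; move: le => /=; lia.
Qed.

Lemma Dyck_uniquely_sorted (k : nat) (w : seq nat) :
  Sn k.*2.+1 w -> avoids312 w -> Dyck k (rev (steps w)) -> uniquely_sorted w.
Proof.
move=> Sw aw Dw; have [_ _ gw] := (Dyck_revP _ _).1 Dw.
have bw : count_mem stepU (steps w) = count_mem stepD (steps w).
  by case: Dw; rewrite !count_rev => -> ->.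
have [||v [pv Ev]] := stack_sort_surj _ _ aw gw bw.
- exact: Sn_is_permutation Sw.
- by rewrite -size_eq0 (Sn_size Sw).
exists v; split=> // v' [pv' Ev']; case/andP: pv => uv _; case/andP: pv' => uv' _.
by apply: stack_sort_inj; rewrite ?Ev ?Ev' ?bw.
Qed.

(** * The sliding operators *)

Lemma index_sort_mono (r : rel nat) (s : seq nat) : transitive r -> total r ->
  antisymmetric r ->
  {in s &, forall x y, (index x (sort r s) <= index y (sort r s)) = r x y}.
Proof.
move=> tr to anti x y xs ys.
have so := sort_sorted to s.
have rf : reflexive r by move=> z; have := to z z; rewrite orbb.
have le u v : u \in s -> v \in s -> index u (sort r s) <= index v (sort r s) -> r u v.
  by move=> us vs; apply: (sorted_leq_index tr rf so); rewrite mem_sort.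
apply/idP/idP => [|rxy]; first exact: le.
rewrite leqNgt; apply/negP => lt.
have E : y = x by apply: anti; rewrite rxy (le _ _ ys xs (ltnW lt)).
by rewrite E ltnn in lt.
Qed.

(** What is retained of [swd_at i], with [p] the position of [i]. Only comparisons between entries
    below [i] on opposite sides of [p] can change, and afterwards the left one is the smaller. *)
Definition slides (i p : nat) (w w' : seq nat) : Prop :=
  [/\ size w' = size w,
      forall j, j < size w -> i <= nth 0 w j -> nth 0 w' j = nth 0 w j,
      forall j, j < size w -> nth 0 w j < i -> 0 < nth 0 w' j < i,
      forall j l, j < size w -> l < size w -> nth 0 w j < i -> nth 0 w l < i ->
        (j < p) = (l < p) -> (nth 0 w' j < nth 0 w' l) = (nth 0 w j < nth 0 w l)
    & forall j l, j < p -> p < l -> l < size w -> nth 0 w j < i -> nth 0 w l < i ->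
        nth 0 w' j < nth 0 w' l].

(** Reversal swaps sides: [SA] collects the entries below [i] on the left of [i] in [w], and [SB]
    those on its right. The former receive the lowest values and the latter the highest values below
    [i], each in its own order. *)
Lemma swd_at_slides (n i : nat) (w : seq nat) : Sn n w -> 0 < i <= n ->
  [/\ index i w < size w, nth 0 w (index i w) = i & slides i (index i w) w (swd_at i w)].
Proof.
move=> Sw hi; have iw : i \in w by rewrite (perm_mem Sw) mem_iota add1n ltnS.
have uw : uniq w by rewrite (perm_uniq Sw) iota_uniq.
set p := index i w; have pw : p < size w by rewrite index_mem.
split=> //; first exact: nth_index.
pose A := take p w; pose B := drop p.+1 w.
have Ew : w = A ++ i :: B by rewrite -{1}(cat_take_drop p w) (drop_nth 0) // nth_index.
have := uw; rewrite {1}Ew cat_uniq /= negb_or => /and3P[uA /andP[iA dAB] /andP[iB uB]].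
have Er : rev w = rev B ++ i :: rev A by rewrite Ew rev_cat rev_cons cat_rcons.
have ir : index i (rev w) = size (rev B).
  by rewrite Er index_cat mem_rev (negPf iB) /= eqxx addn0.
pose SA := [seq x <- rev A | x < i]; pose SB := [seq x <- rev B | x < i].
have ES : left_smaller i (rev w) = SB by rewrite /left_smaller ir Er take_size_cat.
have ES' : right_smaller i (rev w) = SA.
  by rewrite /right_smaller ir Er drop_size_cat //= ltnn.
pose f x := if i <= x then x else if x \in SA then (index x (sort leq SA)).+1
            else i - (index x (sort geq SB)).+1.
have Ef : swd_at i w = map f w by rewrite /swd_at /swu_at ES ES' map_rev revK.
(* Together [SA] and [SB] exhaust the values below [i], so the two blocks of new values do not
   overlap. *)
have sz : size SA + size SB = i.-1.
  rewrite -size_cat -(size_iota 1 i.-1); apply: perm_size; apply: uniq_perm.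
  - rewrite cat_uniq !filter_uniq ?rev_uniq // andbT; apply/hasPn => x.
    rewrite !mem_filter !mem_rev => /andP[_ xB]; rewrite negb_and.
    by apply/orP; right; have /hasPn := dAB; apply.
  - exact: iota_uniq.
  move=> x; rewrite mem_cat !mem_filter !mem_rev -andb_orr mem_iota.
  have := perm_mem Sw x; rewrite {1}Ew mem_cat inE mem_iota.
  case: (x \in A) (x \in B) => [] []; rewrite /= ?orbT ?orbF; lia.
have memA j : j < size w -> nth 0 w j < i -> (nth 0 w j \in SA) = (j < p).
  move=> jw lt; rewrite mem_filter lt mem_rev in_take ?mem_nth //.
  by rewrite index_uniq.
have memB j : j < size w -> nth 0 w j < i -> p <= j -> nth 0 w j \in SB.
  move=> jw lt pj; have := mem_nth 0 jw; rewrite {2}Ew mem_cat inE.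
  have := memA _ jw lt; rewrite !mem_filter lt !mem_rev /= => ->.
  by rewrite ltnNge pj (ltn_eqF lt).
have fA j : j < size w -> nth 0 w j < i -> j < p ->
    nth 0 (map f w) j = (index (nth 0 w j) (sort leq SA)).+1 /\
    index (nth 0 w j) (sort leq SA) < size SA.
  move=> jw lt jp; rewrite (nth_map 0) // /f leqNgt lt memA // jp.
  by rewrite -(size_sort leq) index_mem mem_sort memA.
have fB j : j < size w -> nth 0 w j < i -> p <= j ->
    nth 0 (map f w) j = i - (index (nth 0 w j) (sort geq SB)).+1 /\
    index (nth 0 w j) (sort geq SB) < size SB.
  move=> jw lt jp; rewrite (nth_map 0) // /f leqNgt lt memA // ltnNge jp.
  by rewrite -(size_sort geq) index_mem mem_sort memB.
rewrite Ef; split=> [|j jw le|j jw lt|j l jw lw ltj ltl same|j l jp pl lw ltj ltl].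
- by rewrite size_map.
- by rewrite (nth_map 0) // /f le.
- have [jp|jp] := ltnP j p.
    by have [-> ?] := fA _ jw lt jp; lia.
  by have [-> ?] := fB _ jw lt jp; lia.
- have [jp|jp] := ltnP j p.
    have lp : l < p by rewrite -same.
    have [-> _] := fA _ jw ltj jp; have [-> _] := fA _ lw ltl lp.
    rewrite ltnS ltnNge index_sort_mono ?memA // -?ltnNge //.
    + by move=> ? ? ?; apply: leq_trans.
    + exact: leq_total.
    + exact: anti_leq.
  have lp : p <= l by rewrite leqNgt -same ltnNge jp.
  have [-> hj] := fB _ jw ltj jp; have [-> hl] := fB _ lw ltl lp.
  have := @index_sort_mono geq SB _ _ _ _ _ (memB _ jw ltj jp) (memB _ lw ltl lp).
  rewrite /= => H; rewrite [RHS]ltnNge -H; first by lia.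
  + by move=> x y z /= h1 h2; apply: leq_trans h2 h1.
  + by move=> x y; apply: leq_total.
  + by move=> x y /=; rewrite andbC; apply: anti_leq.
have jw := ltn_trans jp (ltn_trans pl lw).
have [-> hj] := fA _ jw ltj jp; have [-> hl] := fB _ lw ltl (ltnW pl).
by lia.
Qed.

Lemma straddle (p j l : nat) : j <> p -> l <> p -> (j < p) <> (l < p) ->
  (j < p /\ p < l) \/ (l < p /\ p < j).
Proof. by case: (ltngtP j p); case: (ltngtP l p) => //; [left|right]. Qed.

Lemma straddle_lt (p j l : nat) : j < l -> j <> p -> l <> p ->
  (j < p) <> (l < p) -> j < p /\ p < l.
Proof.
move=> jl jp lp /(straddle jp lp)[//|[lp' pj]].
by have := ltn_trans jl (ltn_trans lp' pj); rewrite ltnn.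
Qed.

Lemma slides_cmp (i p : nat) (w w' : seq nat) (j l : nat) :
  slides i p w w' -> j < size w -> l < size w ->
  (nth 0 w j < i -> nth 0 w l < i -> (j < p) = (l < p)) ->
  (nth 0 w' j < nth 0 w' l) = (nth 0 w j < nth 0 w l).
Proof.
case=> _ hi lo cmp _ jw lw same.
have [ji|ij] := ltnP (nth 0 w j) i; have [li|il] := ltnP (nth 0 w l) i.
- by apply: cmp => //; apply: same.
- have /andP[_ a] := lo _ jw ji; rewrite (hi _ lw il).
  by rewrite (leq_trans a il) (leq_trans ji il).
- have /andP[_ a] := lo _ lw li; rewrite (hi _ jw ij).
  by rewrite ltnNge (leq_trans (ltnW a) ij) ltnNge (leq_trans (ltnW li) ij).
- by rewrite !hi.
Qed.

(** The new entries are distinct and lie between 1 and [n], so by pigeonhole they are all of these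
    values. *)
Lemma slides_Sn (n i p : nat) (w w' : seq nat) :
  0 < i <= n -> nth 0 w p = i -> Sn n w -> slides i p w w' -> Sn n w'.
Proof.
move=> /andP[i0 le] Ep Sw sl; have [sz hi lo _ cr] := sl.
have uw : uniq w by rewrite (perm_uniq Sw) iota_uniq.
have sw := Sn_size Sw.
have rng j : j < n -> 0 < nth 0 w j <= n.
  move=> jn; have : nth 0 w j \in w by apply: mem_nth; rewrite sw.
  by rewrite (perm_mem Sw) mem_iota add1n ltnS.
have uw' : uniq w'.
  apply/(uniqP 0) => j l; rewrite !inE sz => jw lw E; apply/eqP.
  have np q : nth 0 w q < i -> q <> p by move=> + qp; rewrite qp Ep ltnn.
  have [ji|ij] := ltnP (nth 0 w j) i; have [li|il] := ltnP (nth 0 w l) i.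
  - have [Ejl|njl] := eqVneq (j < p) (l < p).
      have c1 := slides_cmp sl lw jw (fun _ _ => esym Ejl).
      have c2 := slides_cmp sl jw lw (fun _ _ => Ejl).
      by rewrite -(nth_uniq 0 jw lw uw); move: c1 c2; rewrite E ltnn; case: ltngtP.
    have [[jp pl]|[lp pj]] := straddle (np _ ji) (np _ li) (elimN eqP njl).
    + by have := cr j l jp pl lw ji li; rewrite E ltnn.
    + by have := cr l j lp pj jw li ji; rewrite E ltnn.
  - by have := lo _ jw ji; rewrite E (hi _ lw il) [_ < i]ltnNge il andbF.
  - by have := lo _ lw li; rewrite -E (hi _ jw ij) [_ < i]ltnNge ij andbF.
  - by rewrite -(nth_uniq 0 jw lw uw) -(hi _ jw ij) -(hi _ lw il) E.
have sub : {subset w' <= iota 1 n}.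
  move=> x /(nthP 0) [j]; rewrite sz => jw <-; rewrite mem_iota add1n ltnS.
  have [ji|ij] := ltnP (nth 0 w j) i; last by rewrite hi // rng -?sw.
  by have /andP[-> a] := lo _ jw ji; apply: leq_trans (ltnW a) le.
apply: uniq_perm => //; first exact: iota_uniq.
by have [|_ E x] := uniq_min_size uw' sub; [|exact: E]; rewrite ?size_iota ?sz ?sw.
Qed.

Lemma steps_eq (w w' : seq nat) : size w = size w' ->
  (forall j, j.+1 < size w ->
     (nth 0 w j < nth 0 w j.+1) = (nth 0 w' j < nth 0 w' j.+1)) ->
  steps w = steps w'.
Proof.
move=> sz h; apply: (@eq_from_nth _ stepD); rewrite !size_steps ?sz // => j hj.
have jw : j.+1 < size w' by move: hj; case: (size w').
by rewrite !nth_steps ?h ?sz.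
Qed.

(** Two adjacent positions, both different from [p], cannot lie on opposite sides of [p]. *)
Lemma slides_steps (i p : nat) (w w' : seq nat) :
  nth 0 w p = i -> slides i p w w' -> steps w' = steps w.
Proof.
move=> Ep sl; have [sz _ _ _ _] := sl; apply: steps_eq => // j; rewrite sz => jw.
apply: (slides_cmp sl) => //; first exact: ltnW.
move=> ji li; apply: contrapT => k.
have ne q : nth 0 w q < i -> q <> p by move=> + qp; rewrite qp Ep ltnn.
by have [jp] := straddle_lt (ltnSn j) (ne _ ji) (ne _ li) k; rewrite ltnS leqNgt jp.
Qed.

(** A 312 of [w'] at [a], [b], [c] is one of [w] unless a comparison changed. A changed pair has its
    left entry smaller in [w'], which excludes [a], [c]. If [b], [c] changed, then the entry at [a]
    exceeds [i], and [a], [b], [p] form a 312 of [w]. *)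
Lemma slides_avoids312 (i p : nat) (w w' : seq nat) :
  uniq w -> p < size w -> nth 0 w p = i -> slides i p w w' ->
  avoids312 w -> avoids312 w'.
Proof.
move=> uw pw Ep sl aw a b c ab bc; have [sz hi lo _ cr] := sl; rewrite sz => cw.
have bw := ltn_trans bc cw; have aw' := ltn_trans ab bw.
have ne q : nth 0 w q < i -> q <> p by move=> + qp; rewrite qp Ep ltnn.
case/andP=> h1 h2; have ac := ltn_trans ab bc.
have [k1|/not_implyP[bi /not_implyP[ci k1]]] :=
    pselect (nth 0 w b < i -> nth 0 w c < i -> (b < p) = (c < p)).
  have [k2|/not_implyP[ci /not_implyP[ai k2]]] :=
      pselect (nth 0 w c < i -> nth 0 w a < i -> (c < p) = (a < p)).
    apply: (aw a b c ab bc cw).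
    by rewrite -(slides_cmp sl bw cw k1) -(slides_cmp sl cw aw' k2) h1.
  have [ap pc] := straddle_lt ac (ne _ ai) (ne _ ci) (nesym k2).
  by have := cr a c ap pc cw ai ci; rewrite ltnNge (ltnW h2).
have [bp pc] := straddle_lt bc (ne _ bi) (ne _ ci) k1.
have [ai|ia] := ltnP (nth 0 w a) i.
  by have := cr a c (ltn_trans ab bp) pc cw ai ci; rewrite ltnNge (ltnW h2).
apply: (aw a b p ab bp pw); rewrite Ep bi ltn_neqAle ia andbT -Ep.
by rewrite nth_uniq // gtn_eqF // (ltn_trans ab).
Qed.

(** Only occurrences with top entry at least [m] are excluded. This is the invariant of [swd], which
    treats [n] first and 1 last; at [m = 1] it is full avoidance of 231 for a permutation. *)
Definition avoids231_from (m : nat) (w : seq nat) : Prop :=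
  forall a b c, a < b -> b < c -> c < size w -> m <= nth 0 w b ->
    ~ (nth 0 w c < nth 0 w a < nth 0 w b).

(** In a 231 with top [i], the outer entries are below [i] on opposite sides of it, and the slide
    puts them in increasing order. For the same reason no new 231 with top at least [i] arises. *)
Lemma slides_avoids231 (i p : nat) (w w' : seq nat) :
  uniq w -> p < size w -> nth 0 w p = i -> slides i p w w' ->
  avoids231_from i.+1 w -> avoids231_from i w'.
Proof.
move=> uw pw Ep sl aw a b c ab bc; have [sz hi lo _ cr] := sl; rewrite sz => cw.
have bw := ltn_trans bc cw; have aw' := ltn_trans ab bw.
have ne q : nth 0 w q < i -> q <> p by move=> + qp; rewrite qp Ep ltnn.
move=> ib /andP[h1 h2]; have ac := ltn_trans ab bc.
have ib' : i <= nth 0 w b.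
  by have [/(lo _ bw)/andP[_]|//] := ltnP (nth 0 w b) i; rewrite ltnNge ib.
have k1 : nth 0 w a < i -> nth 0 w b < i -> (a < p) = (b < p) by rewrite [_ b < i]ltnNge ib'.
rewrite (slides_cmp sl aw' bw k1) in h2.
have [k2|/not_implyP[ci /not_implyP[ai k2]]] :=
    pselect (nth 0 w c < i -> nth 0 w a < i -> (c < p) = (a < p)); last first.
  have [ap pc] := straddle_lt ac (ne _ ai) (ne _ ci) (nesym k2).
  by have := cr a c ap pc cw ai ci; rewrite ltnNge (ltnW h1).
rewrite (slides_cmp sl cw aw' k2) in h1.
move: ib'; rewrite leq_eqVlt => /orP[/eqP Eb|ib']; last first.
  by apply: (aw a b c ab bc cw ib'); rewrite h1.
have bp : b = p by apply/eqP; rewrite -(nth_uniq 0 bw pw uw) -Eb Ep.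
have ai : nth 0 w a < i by rewrite Eb.
by have := k2 (ltn_trans h1 ai) ai; rewrite -bp ab ltnNge (ltnW bc).
Qed.

Lemma swd_spec (n : nat) (w : seq nat) : Sn n w -> avoids312 w ->
  [/\ Sn n (swd w), steps (swd w) = steps w, avoids312 (swd w)
    & avoids231_from 1 (swd w)].
Proof.
move=> Sw aw; rewrite /swd (Sn_size Sw).
(* The word [x] is [w] after [swd_at n] down to [swd_at m]. For [j = 0] no entry reaches [m = n.+1],
   so the condition on 231 is vacuous. *)
suff H j m : 0 < m -> m + j = n.+1 -> let x := foldr swd_at w (iota m j) in
    [/\ Sn n x, steps x = steps w, avoids312 x & avoids231_from m x] by exact: H.
elim: j m => [|j IH] m m0 Em /=.
  split=> // a b c _ bc cw mb _; have : nth 0 w b \in w by apply/mem_nth/(ltn_trans bc).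
  by rewrite (perm_mem Sw) mem_iota add1n -Em addn0 [_ < m]ltnNge mb andbF.
have [//||Sx <- ax bx] := IH m.+1; first by rewrite addSnnS.
have mn : 0 < m <= n by rewrite m0 -ltnS -Em addnS ltnS leq_addr.
set x := foldr _ _ _ in Sx ax bx *.
have [pw Ep sl] := swd_at_slides Sx mn.
have ux : uniq x by rewrite (perm_uniq Sx) iota_uniq.
split.
- exact: slides_Sn mn Ep Sx sl.
- exact: slides_steps Ep sl.
- exact: slides_avoids312 ux pw Ep sl ax.
- exact: slides_avoids231 ux pw Ep sl bx.
Qed.

(** * Layered permutations *)

Lemma Sn_count_le (n m : nat) (w : seq nat) :
  Sn n w -> m <= n -> count (fun x => x <= m) w = m.
Proof.
move=> /permP-> mn; rewrite -(subnKC mn) iotaD count_cat.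
rewrite (_ : count _ (iota 1 m) = m); last first.
  rewrite -[RHS](size_iota 1 m); apply/eqP; rewrite -all_count.
  by apply/allP => x; rewrite mem_iota add1n ltnS => /andP[].
rewrite (_ : count _ _ = 0) ?addn0 //; apply/eqP; rewrite -leqn0 leqNgt -has_count.
by apply/hasPn => x; rewrite mem_iota add1n -ltnNge => /andP[].
Qed.

(** Exactly [m] entries are at most [m]. Under either alternative, a count of those in an initial or
    final segment shows that they fill the first [m] positions. *)
Lemma layered_split (n m : nat) (w : seq nat) :
  Sn n w -> m <= n ->
  (forall p q, p < m -> m <= q -> q < n -> nth 0 w p < nth 0 w q) \/
  (forall p q, p < n -> q < n -> nth 0 w p <= m -> m < nth 0 w q -> p < q) ->
  forall p, p < n -> (p < m) = (nth 0 w p <= m).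
Proof.
move=> Sw mn H; have sw := Sn_size Sw; have cw := Sn_count_le Sw mn.
have ct s : count (fun x => x <= m) (take s w) + count (fun x => x <= m) (drop s w) = m.
  by rewrite -count_cat cat_take_drop.
suff lo p : p < m -> nth 0 w p <= m.
  move=> p pn; apply/idP/idP => [/lo//|pm]; rewrite ltnNge; apply/negP => mp.
  have c1 : count (fun x => x <= m) (take m w) = m.
    rewrite -[RHS](size_takel (_ : m <= size w)) ?sw //; apply/eqP; rewrite -all_count.
    apply/(all_nthP 0) => j; rewrite size_takel ?sw // => jm.
    by rewrite nth_take // lo.
  have := ct m; rewrite c1 -[RHS]addn0 => /eqP; rewrite eqn_add2l.
  rewrite -leqn0 leqNgt -has_count => /hasP[]; exists (nth 0 w p) => //.
  rewrite -(subnKC mp) -nth_drop mem_nth // size_drop sw; apply: ltn_sub2r => //.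
  exact: leq_ltn_trans mp pn.
move=> pm; rewrite leqNgt; apply/negP => mp; have pn := leq_trans pm mn.
case: H => H.
  have /eqP : count (fun x => x <= m) (drop m w) = 0.
    apply/eqP; rewrite -leqn0 leqNgt -has_count; apply/(has_nthP 0) => -[j].
    rewrite size_drop sw nth_drop ltn_subRL => jn.
    by rewrite leqNgt (ltn_trans mp) // H // leq_addr.
  move=> /eqP E; have : count (fun x => x <= m) (take m w) == size (take m w).
    by have := ct m; rewrite E addn0 size_takel ?sw // => ->.
  rewrite -all_count => /(all_nthP 0) /(_ p).
  by rewrite size_takel ?sw // nth_take // => /(_ pm); rewrite leqNgt mp.
have c0 : count (fun x => x <= m) (drop p w) = 0.
  apply/eqP; rewrite -leqn0 leqNgt -has_count; apply/(has_nthP 0) => -[j].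
  rewrite size_drop sw nth_drop ltn_subRL => jn jm.
  by have := H _ _ jn pn jm mp; rewrite ltnNge leq_addr.
have := count_size (fun x => x <= m) (take p w).
by have := ct p; rewrite c0 addn0 => ->; rewrite size_takel ?sw ?(ltnW pn) // leqNgt pm.
Qed.

(* A layered permutation is an involution, so it has the same descents as its inverse. *)
Lemma layered_Des_inverse (n m : nat) (w : seq nat) :
  Sn n w -> avoids312 w -> avoids231_from 1 w -> 0 < m < n ->
  (index m w < index m.+1 w) = (nth 0 w m.-1 < nth 0 w m).
Proof.
move=> Sw a3 a2' /andP[m0 mn]; have sw := Sn_size Sw.
have uw : uniq w by rewrite (perm_uniq Sw) iota_uniq.
have pos p : p < n -> 0 < nth 0 w p.
  move=> pn; have : nth 0 w p \in w by apply: mem_nth; rewrite sw.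
  by rewrite (perm_mem Sw) mem_iota => /andP[].
have a2 a b c : a < b -> b < c -> c < n -> ~ (nth 0 w c < nth 0 w a < nth 0 w b).
  by move=> ab bc cn; apply: a2' => //; rewrite ?sw // pos // (ltn_trans bc).
rewrite /avoids312 sw in a3.
have inw v : 0 < v <= n -> index v w < n /\ nth 0 w (index v w) = v.
  move=> hv; have vw : v \in w by rewrite (perm_mem Sw) mem_iota add1n ltnS.
  by rewrite -{1}sw index_mem nth_index.
have [Pn EP] := inw m ltac:(by rewrite m0 ltnW).
have [Qn EQ] := inw m.+1 mn.
have neq a b : a < n -> b < n -> a < b -> nth 0 w a != nth 0 w b.
  by move=> an bn ab; rewrite nth_uniq ?sw // ltn_eqF.
(* Both inequalities are compared with one condition: the first [m] positions carry the values 1 to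
   [m]. It implies both; conversely, if either inequality held without it, a 312 or a 231 would
   appear. *)
have both : (forall p, p < n -> (p < m) = (nth 0 w p <= m)) ->
    (index m w < index m.+1 w) && (nth 0 w m.-1 < nth 0 w m).
  move=> H; have := H _ Pn; have := H _ Qn; rewrite EP EQ leqnn ltnn => Q P.
  have -> /= : index m w < index m.+1 w by apply: (@leq_trans m); rewrite ?P // leqNgt Q.
  have := H m mn; have := H m.-1 ltac:(by rewrite prednK // ltnW).
  rewrite prednK // leqnn ltnn => h1 h2.
  by rewrite (leq_ltn_trans (esym h1)) // ltnNge -h2.
apply/idP/idP => lt.
  have /both /andP[]// : forall p, p < n -> (p < m) = (nth 0 w p <= m).
  apply: layered_split Sw (ltnW mn) _; right=> p q pn qn pm mq.
  rewrite ltnNge leq_eqVlt; apply/negP => /orP[/eqP E|qp].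
    by rewrite -E leqNgt mq in pm.
  have mq' : q < index m.+1 w -> m.+1 < nth 0 w q.
    move=> qQ; rewrite ltn_neqAle mq andbT -{1}EQ eq_sym.
    exact: neq.
  have [pP|Pp] := leqP p (index m w).
    have pQ := leq_ltn_trans pP lt; apply: (a3 q p (index m.+1 w)) => //.
    by rewrite EQ ltnS pm mq' // (ltn_trans qp).
  have [qP|Pq|E] := ltngtP q (index m w); last by rewrite E EP ltnn in mq.
    apply: (a3 q (index m w) (index m.+1 w)) => //.
    by rewrite EQ EP ltnSn mq' // (ltn_trans qP).
  apply: (a2 (index m w) q p) => //; rewrite EP mq andbT ltn_neqAle pm andbT.
  by rewrite -[in X in _ != X]EP eq_sym neq.
have /both /andP[]// : forall p, p < n -> (p < m) = (nth 0 w p <= m).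
apply: layered_split Sw (ltnW mn) _; left=> p q pm mq qn.
have sm : m.-1 < m by rewrite prednK.
have sn := ltn_trans sm mn; have pn := ltn_trans pm mn.
rewrite ltnNge leq_eqVlt negb_or eq_sym (neq p q pn qn (leq_trans pm mq)) /=.
apply/negP => qp.
have sq : nth 0 w m.-1 < nth 0 w q.
  rewrite ltnNge leq_eqVlt negb_or eq_sym (neq _ q sn qn (leq_trans sm mq)) /=.
  apply/negP => qs.
  move: mq; rewrite leq_eqVlt => /orP[/eqP E|mq].
    by have := ltn_trans qs lt; rewrite -E ltnn.
  by apply: (a2 m.-1 m q) => //; rewrite qs.
have ps : p < m.-1.
  rewrite ltn_neqAle -ltnS prednK // pm andbT; apply/eqP => E.
  by have := ltn_trans sq qp; rewrite E ltnn.
by apply: (a3 p m.-1 q) => //; [exact: leq_trans sm mq | rewrite sq].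
Qed.

Lemma DL1_steps (k : nat) (w : seq nat) :
  uniq w -> size w = k.*2.+1 -> (DL k w).1 = rev (steps w).
Proof.
move=> uw sw; apply: (@eq_from_nth _ stepD).
  by rewrite size_rev size_steps sw size_map size_iota.
move=> i; rewrite size_map size_iota => ik.
rewrite (nth_map 0) ?size_iota // nth_iota // add1n subSS.
rewrite nth_rev ?size_steps sw //= nth_steps; last by rewrite sw; clear -ik; lia.
rewrite mem_filter mem_iota sw /= add1n ltnS leq_subr subn_gt0 ik andbT.
rewrite -subSn // subSS andbT -subnS.
have d : nth 0 w (k.*2 - i.+1) != nth 0 w (k.*2 - i).
  by rewrite nth_uniq ?sw ?ltnS ?leq_subr //; clear -ik; apply/eqP; lia.
by case: ltngtP d.
Qed.

(** As [rot_perm] reverses the inverse, its descents are the ascents of the inverse read backwards;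
    for a layered word these are the ascents of [w] itself. *)
Lemma DL2_steps (k : nat) (w : seq nat) :
  Sn k.*2.+1 w -> avoids312 w -> avoids231_from 1 w -> (DL k w).2 = rev (steps w).
Proof.
move=> Sw a3 a2; have sw := Sn_size Sw; apply: (@eq_from_nth _ stepD).
  by rewrite size_rev size_steps sw size_map size_iota.
move=> i; rewrite size_map size_iota => ik.
rewrite (nth_map 0) ?size_iota // nth_iota // add1n.
rewrite nth_rev ?size_steps sw //= nth_steps; last by rewrite sw; clear -ik; lia.
have sr : size (rot_perm w) = k.*2.+1 by rewrite size_rev size_map size_iota.
rewrite mem_filter mem_iota sr /= add1n ltnS ik andbT.
have nr j : j < k.*2.+1 -> nth 0 (rot_perm w) j = (index (k.*2.+1 - j) w).+1.
  move=> jk; rewrite /rot_perm nth_rev size_map size_iota sw //.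
  rewrite subSS /inverse sw (nth_map 0) ?size_iota ?ltnS ?leq_subr //.
  by rewrite nth_iota ?ltnS ?leq_subr // add1n -subSn.
rewrite !nr //; last exact: ltnW.
rewrite ltnS subSS subSn ?(ltnW ik) // (layered_Des_inverse Sw a3 a2); last first.
  by rewrite subn_gt0 ik ltnS leq_subr.
by rewrite -subnS -subSn // subSS; case: ltnP.
Qed.

(** * Words avoiding 132 and 312 *)

Lemma subseq_consP (x : nat) (s w : seq nat) :
  subseq (x :: s) w <->
  exists2 j, j < size w & nth 0 w j = x /\ subseq s (drop j.+1 w).
Proof.
split=> [|[j jw [<- sub]]]; last first.
  suff sj : subseq (nth 0 w j :: s) (drop j w) by apply: subseq_trans sj (drop_subseq w j).
  by rewrite (drop_nth 0 jw) /= eqxx.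
elim: w => [//|y w IH]; rewrite [subseq _ _]/=; case: eqP => [<-|_] sub.
  by exists 0; rewrite //= drop0.
by have [j jw [E sj]] := IH sub; exists j.+1.
Qed.

Lemma avoids3P (w : seq nat) (x y z : nat) :
  avoids w [:: x; y; z] <->
  forall a b c, a < b -> b < c -> c < size w ->
    ~ same_relative_order [:: nth 0 w a; nth 0 w b; nth 0 w c] [:: x; y; z].
Proof.
split=> [av a b c ab bc cw so|av [u [sub so]]].
  apply: av; exists [:: nth 0 w a; nth 0 w b; nth 0 w c]; split=> //.
  have aw := ltn_trans ab (ltn_trans bc cw); have bw := ltn_trans bc cw.
  apply/subseq_consP; exists a => //; split=> //.
  apply/subseq_consP; exists (b - a.+1); first by rewrite size_drop ltn_sub2r // (leq_ltn_trans ab).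
  rewrite nth_drop subnKC // drop_drop addSn subnK //; split=> //.
  apply/subseq_consP; exists (c - b.+1); first by rewrite size_drop ltn_sub2r // (leq_ltn_trans bc).
  by rewrite nth_drop subnKC ?sub0seq.
have su := proj1 so; case: u so sub su => [|a' [|b' [|c' [|]]]] // so.
case/subseq_consP => a aw [Ea] /subseq_consP[b bw [Eb]] /subseq_consP[c cw [Ec _]] _.
move: bw cw Eb Ec; rewrite !drop_drop !nth_drop !size_drop => bw cw Eb Ec.
subst a' b' c'; apply: (av _ _ _ _ _ _ so).
- by rewrite addSn ltnS leq_addr.
- by clear; lia.
- by clear -cw; lia.
Qed.

Lemma avoids312P (w : seq nat) : avoids w [:: 3; 1; 2] <-> avoids312 w.
Proof.
rewrite avoids3P; split=> av a b c ab bc cw h; apply: av ab bc cw _.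
  move: (nth 0 w a) (nth 0 w b) (nth 0 w c) h => x y z /andP[yz zx].
  by split=> // -[|[|[|i]]] [|[|[|j]]] //= _ _; clear -yz zx; lia.
by case: h => _ h; rewrite (h 1 2) // (h 2 0).
Qed.

(** The positions [a] and [b] are not ordered: [a < b] gives the pattern 132 and [b < a] gives
    312. *)
Definition extremal_entries (w : seq nat) : Prop :=
  forall a b c, a < c -> b < c -> c < size w -> ~ (nth 0 w a < nth 0 w c < nth 0 w b).

Lemma avoids132_312P (w : seq nat) :
  avoids w [:: 1; 3; 2] /\ avoids w [:: 3; 1; 2] <-> extremal_entries w.
Proof.
rewrite avoids312P avoids3P; split=> [[av1 av2] a b c ac bc cw h|ex].
  have [ab|ba|E] := ltngtP a b; last by case/andP: h => h1; rewrite -E ltnNge (ltnW h1).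
    apply: av1 ab bc cw _; move: (nth 0 w a) (nth 0 w b) (nth 0 w c) h => x y z /andP[xz zy].
    by split=> // -[|[|[|i]]] [|[|[|j]]] //= _ _; clear -xz zy; lia.
  by apply: av2 ba ac cw _.
split=> a b c ab bc cw h.
  by apply: (ex a b c (ltn_trans ab bc) bc cw); case: h => _ h; rewrite (h 0 2) // (h 2 1).
by apply: (ex b a c bc (ltn_trans ab bc) cw).
Qed.

Lemma extremal_rcons (w : seq nat) (x : nat) :
  extremal_entries (rcons w x) <->
  extremal_entries w /\ (forall y z, y \in w -> z \in w -> ~ (y < x < z)).
Proof.
split=> [ex|[ex ux] a b c ac bc]; last first.
  rewrite size_rcons ltnS leq_eqVlt => /orP[/eqP E|cw].
    rewrite !nth_rcons -E ac bc ltnn eqxx; apply: ux; apply: mem_nth; by rewrite -E.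
  rewrite !nth_rcons cw (ltn_trans ac cw) (ltn_trans bc cw).
  exact: ex.
split=> [a b c ac bc cw|y z /(nthP 0)[a aw <-] /(nthP 0)[b bw <-]].
  have := ex a b c ac bc; rewrite size_rcons !nth_rcons cw (ltn_trans ac cw) (ltn_trans bc cw).
  by apply; apply: ltnW.
have := ex a b (size w) aw bw; rewrite size_rcons !nth_rcons aw bw ltnn eqxx.
exact.
Qed.

Lemma extremal_mapS (w : seq nat) :
  extremal_entries (map S w) <-> extremal_entries w.
Proof.
have H a b c : a < c -> b < c -> c < size w ->
    (nth 0 (map S w) a < nth 0 (map S w) c < nth 0 (map S w) b) =
    (nth 0 w a < nth 0 w c < nth 0 w b).
  by move=> ac bc cw; rewrite !(nth_map 0) ?ltnS // (ltn_trans _ cw).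
split=> ex a b c ac bc cw.
  by rewrite -H //; apply: ex => //; rewrite size_map.
by rewrite size_map in cw; rewrite H //; apply: ex.
Qed.

Lemma steps_rcons (w : seq nat) (x : nat) :
  w != [::] -> steps (rcons w x) = rcons (steps w) (last 0 w < x).
Proof. by move=> w0; rewrite -cats1 steps_cat // cats1. Qed.

Lemma steps_mapS (w : seq nat) : steps (map S w) = steps w.
Proof.
apply: steps_eq; rewrite size_map // => j jw.
by rewrite !(nth_map 0) // ltnW.
Qed.

(** Inverse of [rev (steps w)] on these words. The head of [p] is the last step, so it decides
    whether the last entry is the maximum, or is 1 with all earlier entries shifted up. *)
Fixpoint of_steps (p : seq bool) : seq nat :=
  if p is b :: p' then
    if b then rcons (of_steps p') (size p').+2 else rcons (map S (of_steps p')) 1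
  else [:: 1].

Lemma iota1_rcons (n : nat) : iota 1 n.+1 = rcons (iota 1 n) n.+1.
Proof. by rewrite -[n.+1 in LHS]addn1 iotaD cats1 add1n. Qed.

Lemma iota1_cons (n : nat) : iota 1 n.+1 = 1 :: map S (iota 1 n).
Proof. by rewrite /= -[2]/(1 + 1) iotaDl. Qed.

Lemma of_steps_Sn (p : seq bool) : Sn (size p).+1 (of_steps p).
Proof.
elim: p => [|b p IH] //=; rewrite /Sn /mkset; case: b.
  by rewrite iota1_rcons perm_rcons perm_sym perm_rcons perm_cons perm_sym.
by rewrite iota1_cons perm_rcons perm_cons perm_map.
Qed.

Lemma of_steps_neq0 (p : seq bool) : of_steps p != [::].
Proof. by rewrite -size_eq0 (Sn_size (of_steps_Sn p)). Qed.

Lemma mem_Sn (n : nat) (w : seq nat) (x : nat) : Sn n w -> (x \in w) = (0 < x <= n).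
Proof. by move=> /perm_mem ->; rewrite mem_iota add1n ltnS. Qed.

Lemma mem_last0 (w : seq nat) : w != [::] -> last 0 w \in w.
Proof. by case: w => //= x w _; apply: mem_last. Qed.

Lemma of_stepsK (p : seq bool) : rev (steps (of_steps p)) = p.
Proof.
elim: p => [|b p IH] //=; have ne := of_steps_neq0 p.
have ml := mem_last0 ne; rewrite (mem_Sn _ (of_steps_Sn p)) in ml.
case: b; rewrite steps_rcons ?rev_rcons ?steps_mapS ?IH //.
- by congr (_ :: _); rewrite ltnS; case/andP: ml.
- by case: (of_steps p) ne => //= x s _; rewrite last_map.
- by case: (of_steps p) ne.
Qed.

Lemma of_steps_extremal (p : seq bool) : extremal_entries (of_steps p).
Proof.
elim: p => [|b p IH] /=; first by move=> a b [|c].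
case: b; apply/extremal_rcons; split=> //.
- move=> y z _; rewrite (mem_Sn _ (of_steps_Sn p)) => /andP[_ zp] /andP[_].
  by rewrite ltnNge (leq_trans zp).
- exact/extremal_mapS.
by move=> y z /mapP[x _ ->].
Qed.

(** The last entry is 1 or the maximum, since otherwise both occur earlier and enclose it. The last
    step tells which, and the rest follows by induction. *)
Lemma steps_of_stepsK (n : nat) (w : seq nat) :
  Sn n.+1 w -> extremal_entries w -> of_steps (rev (steps w)) = w.
Proof.
elim: n w => [|n IH] w Sw ex.
  by have /perm_small_eq -> // := Sw.
case/lastP: w Sw ex => [/Sn_size//|w x] Sw /extremal_rcons[ex nx].
have sw : size w = n.+1 by apply: succn_inj; rewrite -(Sn_size Sw) size_rcons.
have w0 : w != [::] by rewrite -size_eq0 sw.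
have [Ex|xn] := eqVneq x n.+2.
  have Sw' : Sn n.+1 w.
    move: Sw; rewrite /Sn /mkset Ex iota1_rcons perm_rcons perm_sym perm_rcons.
    by rewrite perm_cons perm_sym.
  have ml := mem_last0 w0; rewrite (mem_Sn _ Sw') in ml.
  rewrite steps_rcons // rev_rcons Ex ltnS; case/andP: ml => _ -> /=.
  by rewrite IH // size_rev size_steps sw.
have x1 : x = 1.
  apply/eqP; apply/negPn/negP => x1; have := nx 1 n.+2.
  have := mem_Sn x Sw; rewrite mem_rcons mem_head => /esym/andP[x0 xn'].
  have := mem_Sn 1 Sw; have := mem_Sn n.+2 Sw.
  rewrite !mem_rcons !inE leqnn (eq_sym 1) (negPf x1) (eq_sym n.+2) (negPf xn) /=.
  move=> -> -> /(_ isT isT); apply.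
  by rewrite ltn_neqAle eq_sym x1 x0 ltn_neqAle xn.
have [v Ew] : exists v, w = map S v.
  exists (map predn w); rewrite -map_comp -[LHS]map_id; apply/eq_in_map => y yw /=.
  by rewrite prednK //; have := mem_Sn y Sw; rewrite mem_rcons inE yw orbT => /esym/andP[].
subst x w; have Sv : Sn n.+1 v.
  by move: Sw; rewrite /Sn /mkset iota1_cons perm_rcons perm_cons => /(perm_map_inj succn_inj).
rewrite steps_rcons // rev_rcons steps_mapS.
have -> : last 0 (map S v) < 1 = false by have /mapP[y _ ->] := mem_last0 w0.
by rewrite /= IH //; apply/extremal_mapS.
Qed.

(** * Counting Dyck paths *)

(* The words that lead from height [h] down to 0 in [n] steps, never below 0. *)
Fixpoint ballot (n h : nat) : seq (seq bool) :=
  match n, h with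
  | 0, 0 => [:: [::]]
  | 0, _ => [::]
  | n'.+1, 0 => map (cons stepU) (ballot n' 1)
  | n'.+1, h'.+1 => map (cons stepU) (ballot n' h'.+2) ++ map (cons stepD) (ballot n' h')
  end.

Lemma uniq_ballot (n h : nat) : uniq (ballot n h).
Proof.
have inj b : injective (cons b : seq bool -> seq bool) by move=> p q [].
elim: n h => [|n IH] [|h] //=; first by rewrite map_inj_uniq.
rewrite cat_uniq !map_inj_uniq // !IH andbT /=.
by apply/hasPn => _ /mapP[p _ ->]; apply/mapP => -[].
Qed.

Lemma mem_ballot_cons (b : bool) (p : seq bool) (n h : nat) :
  (b :: p \in ballot n.+1 h) =
  if b then p \in ballot n h.+1 else if h is h'.+1 then p \in ballot n h' else false.
Proof.
have inj c : injective (cons c : seq bool -> seq bool) by move=> u v [].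
have ne (c : bool) s : c <> b -> (b :: p \in map (cons c) s) = false.
  by move=> cb; apply/mapP => -[q _ [E _]]; apply: cb.
case: h => [|h] /=; first by case: b ne => ne; rewrite ?(mem_map (inj _)) // ne.
by rewrite mem_cat; case: b ne => ne; rewrite (mem_map (inj _)) ne ?orbF.
Qed.

Lemma mem_ballot (n h : nat) (p : seq bool) :
  p \in ballot n h <->
  [/\ size p = n, count_mem stepU p + h = count_mem stepD p
    & forall m, count_mem stepD (take m p) <= count_mem stepU (take m p) + h].
Proof.
elim: p n h => [|b p IH] n h.
  split=> [|[<- /= + _]]; last by case: h.
  case: n h => [|n] [|h] //=.
    by move=> /mapP[].
  by rewrite mem_cat => /orP[] /mapP[].
case: n => [|n]; first by split=> [|[]//]; case: h.
rewrite mem_ballot_cons; case: b.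
  rewrite IH; split=> [[<- E le]|[[<-] E le]]; split=> //.
  - by move: E => /=; clear; lia.
  - by case=> [|m] //=; have := le m => /=; clear; lia.
  - by move: E => /=; clear; lia.
  - by move=> m; have := le m.+1; rewrite /=; clear; lia.
case: h => [|h]; first by split=> // -[_ _ /(_ 1)]; rewrite /= take0.
rewrite IH; split=> [[<- E le]|[[<-] E le]]; split=> //.
- by move: E => /=; clear; lia.
- by case=> [|m] //=; have := le m => /=; clear; lia.
- by move: E => /=; clear; lia.
- by move=> m; have := le m.+1; rewrite /=; clear; lia.
Qed.

Lemma Dyck_ballot (k : nat) (p : seq bool) : Dyck k p <-> p \in ballot k.*2 0.
Proof.
have cp : count_mem stepU p + count_mem stepD p = size p.
  by rewrite -(count_predC (pred1 stepU)); congr (_ + _); apply: eq_count; case.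
rewrite mem_ballot addn0; split=> [[hU hD h]|[sz E h]]; split=> //.
- by rewrite -cp hU hD addnn.
- by rewrite hU hD.
- by move=> m; rewrite addn0.
- by apply: double_inj; rewrite -addnn {2}E cp.
- by apply: double_inj; rewrite -addnn -{1}E cp.
by move=> m; rewrite -[leqRHS]addn0.
Qed.

(* By the reflection principle, among the words with [j] up-steps and [j + h] down-steps,
   those that go below 0 are as many as the words with [j - 1] up-steps. *)
Lemma size_ballot (n j h : nat) : n = j.*2 + h ->
  size (ballot n h) + (if j is j'.+1 then 'C(n, j') else 0) = 'C(n, j).
Proof.
have high m : forall g, m < g -> size (ballot m g) = 0.
  elim: m => [|m IHm] [|g] //= mg; rewrite size_cat !size_map !IHm //.
  by apply: ltnW; apply: ltnW.
have pascal m l : 'C(m.+1, l) = 'C(m, l) + (if l is l'.+1 then 'C(m, l') else 0).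
  by case: l => [|l]; rewrite ?bin0 // binS.
elim: n j h => [|n IH] j [|h] En.
- by case: j En.
- by rewrite addnS in En.
- case: j En => [//|j]; rewrite addn0 doubleS => -[En].
  have En1 : n = j.*2 + 1 by rewrite addn1.
  have := IH j 1 En1; rewrite /= size_map !pascal => <-.
  (* Here [n] is [j.*2.+1], so these are the two equal middle coefficients. *)
  have -> : 'C(n, j.+1) = 'C(n, j).
    rewrite -(@bin_sub n j.+1) En ?ltnS -addnn ?leq_addr //.
    by rewrite subSS addnK.
  by rewrite -(IH j 1 En1); clear; lia.
move: En; rewrite addnS => -[En]; rewrite /= size_cat !size_map.
(* Without up-steps only the word of down-steps remains; the branch that starts upwards is too high
   to return, by [high]. *)
case: j En => [|j] En; first by rewrite high ?En //; have := IH 0 h En; rewrite En !bin0.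
have En2 : n = j.*2 + h.+2 by rewrite En doubleS !addnS.
have := IH j _ En2; have := IH j.+1 _ En; rewrite !pascal; clear; lia.
Qed.

Lemma size_ballot_catalan (k : nat) : size (ballot k.*2 0) = catalan k.
Proof.
have := @size_ballot k.*2 k 0; rewrite addn0 => /(_ erefl) h.
apply/eqP; rewrite -(eqn_pmul2l (ltn0Sn k)) catalanE; move: h.
case: k => [//|k] h.
(* Symmetry moves the subtracted coefficient to the other side of the middle, where [mul_bin_left]
   relates it to the central one. *)
have E : 'C(k.+1.*2, k) = 'C(k.+1.*2, k.+2).
  rewrite -(@bin_sub k.+1.*2 k.+2) -addnn; last by clear; lia.
  by congr 'C(_, _); clear; lia.
have := mul_bin_left k.+1.*2 k.+1; rewrite -[X in X - _]addnn addnK -E.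
by move: h; clear; nia.
Qed.

(** * The bijection and the count *)

Lemma Uav132_312P (k : nat) (w : seq nat) :
  Uav k.*2.+1 [:: [:: 1; 3; 2]; [:: 3; 1; 2]] w <->
  [/\ Sn k.*2.+1 w, extremal_entries w & Dyck k (rev (steps w))].
Proof.
split=> [[Sw us av]|[Sw ex Dw]].
  split=> //; last exact: uniquely_sorted_Dyck.
  by apply/avoids132_312P; split; apply: av; rewrite !inE eqxx ?orbT.
have [av1 av2] := (avoids132_312P w).2 ex.
split=> //; first by apply: Dyck_uniquely_sorted Dw => //; apply/avoids312P.
by move=> tau; rewrite !inE => /orP[] /eqP ->.
Qed.

Lemma extremal_avoids312 (w : seq nat) : extremal_entries w -> avoids312 w.
Proof. by move=> /avoids132_312P[_ /avoids312P]. Qed.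

Lemma DL_swd (k : nat) (w : seq nat) :
  Sn k.*2.+1 w -> avoids312 w -> DL k (swd w) = (rev (steps w), rev (steps w)).
Proof.
move=> Sw aw; have [Sx Ex ax bx] := swd_spec Sw aw.
rewrite [LHS]surjective_pairing DL2_steps // DL1_steps ?Ex ?(Sn_size Sx) //.
by rewrite (perm_uniq Sx) iota_uniq.
Qed.

Lemma swd_Uav312 (k : nat) (w : seq nat) :
  Sn k.*2.+1 w -> avoids312 w -> Dyck k (rev (steps w)) ->
  Uav k.*2.+1 [:: [:: 3; 1; 2]] (swd w).
Proof.
move=> Sw aw; have [Sx <- ax _] := swd_spec Sw aw => Dx.
split=> //; first exact: Dyck_uniquely_sorted Dx.
by move=> tau; rewrite inE => /eqP ->; apply/avoids312P.
Qed.

Lemma of_steps_Uav (k : nat) (p : seq bool) :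
  Dyck k p -> Uav k.*2.+1 [:: [:: 1; 3; 2]; [:: 3; 1; 2]] (of_steps p).
Proof.
move=> Dp; apply/Uav132_312P; rewrite of_stepsK; split=> //.
  have [<- _ _] : [/\ size (rev p) = k.*2, count_mem stepU (rev p) = k
                   & suffix_nonneg (rev p)] by apply/Dyck_revP; rewrite revK.
  by rewrite size_rev; apply: of_steps_Sn.
exact: of_steps_extremal.
Qed.

Theorem theorem9p4 (k : nat) :
  let A := Uav k.*2.+1 [:: [:: 1; 3; 2]; [:: 3; 1; 2]] in
  [/\ swd @` A `<=` Uav k.*2.+1 [:: [:: 3; 1; 2]],
      Int_antichain k = [set (p, p) | p in Dyck k],
      set_bij A (Int_antichain k) (fun w => DL k (swd w))
    & (A #= `I_(catalan k))%card].
Proof.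
move=> A.
have inj w v : A w -> A v -> rev (steps w) = rev (steps v) -> w = v.
  move=> /Uav132_312P[Sw ew _] /Uav132_312P[Sv ev _] E.
  by rewrite -(steps_of_stepsK Sw ew) E (steps_of_stepsK Sv ev).
have DLA w : A w -> DL k (swd w) = (rev (steps w), rev (steps w)).
  by move=> /Uav132_312P[Sw ew _]; apply: DL_swd => //; apply: extremal_avoids312.
split.
- move=> _ [w /Uav132_312P[Sw ew Dw] <-].
  by apply: swd_Uav312 => //; apply: extremal_avoids312.
- by apply/seteqP; split=> [[p q] [/= Dp _ <-]|_ [p Dp <-]] //; exists p.
- split=> [w Aw|w v|[p q] [/= Dp _ <-]].
  + by rewrite /= DLA //; have /Uav132_312P[] := Aw.
  + by rewrite !inE => Aw Av; rewrite !DLA // => -[E _]; apply: inj.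
  exists (of_steps p); first exact: of_steps_Uav.
  by rewrite /= DLA ?of_stepsK //; apply: of_steps_Uav.
(* A word is numbered by the rank of its Dyck word in the duplicate-free list [ballot k.*2 0], whose
   length is the Catalan number. *)
apply/card_set_bijP; exists (fun w => index (rev (steps w)) (ballot k.*2 0)).
have mem w : A w -> rev (steps w) \in ballot k.*2 0.
  by move=> /Uav132_312P[_ _ /Dyck_ballot].
split=> [w Aw|w v|i /= ib].
- by rewrite /= -size_ballot_catalan index_mem mem.
- rewrite !inE => Aw Av E; apply: inj => //.
  by rewrite -(nth_index [::] (mem _ Aw)) E nth_index ?mem.
rewrite -size_ballot_catalan in ib.
exists (of_steps (nth [::] (ballot k.*2 0) i)).
  by apply/of_steps_Uav/Dyck_ballot/mem_nth.
by rewrite of_stepsK index_uniq ?uniq_ballot.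
Qed.
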